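(* Let $f=f(x,y,p)$ and $h=h(x,y)$ be smooth functions, and let $L=2\varrho\frac{\partial^2}{\partial\varrho^2}-3\frac{\partial}{\partial\varrho}-\tfrac18\frac{\partial^2}{\partial p^2}$. The general solution, vanishing at $\varrho=0$, to the linear system $$\begin{aligned}LA&=\tfrac9{40}f_{pppp},\\ LB&=-\tfrac1{36}A_p+\tfrac3{40}f_{ppp}+\tfrac9{20}h_y,\\ LC&=-\tfrac1{18}B_p+\tfrac1{324}A+\tfrac1{30}f_{pp}-\tfrac2{15}h^2+\tfrac15(ph_y+h_x)\end{aligned}$$ for functions $A,B,C$ of $(x,y,p,\varrho)$ is given by $$\begin{aligned}A=&\ \frac35\sum_{k=1}^\infty\frac{(2k-1)(2k-3)}{2^{2k}(2k)!}\frac{\partial^{2k+2}f}{\partial p^{2k+2}}\varrho^k+60\,\varrho^{5/2}\sum_{k=0}^\infty\frac{(k+2)(k+1)}{2^{2k}(2k+5)!}\frac{\partial^{2k}\alpha_0}{\partial p^{2k}}\varrho^k,\\ B=&-\frac3{20}\varrho h_y-\frac1{15}\sum_{k=1}^\infty\frac{(2k-1)(2k-3)(2k-5)}{2^{2k}(2k)!}\frac{\partial^{2k+1}f}{\partial p^{2k+1}}\varrho^k\\&+\frac{20}3\varrho^{5/2}\sum_{k=0}^\infty\frac{(k+1)(k+2)}{2^{2k}(2k+5)!}\Big(9\frac{\partial^{2k}\beta_0}{\partial p^{2k}}-2k\frac{\partial^{2k-1}\alpha_0}{\partial p^{2k-1}}\Big)\varrho^k,\\ C=&\ \frac2{45}\varrho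 h^2-\frac1{15}\varrho(ph_y+h_x)+\frac2{135}\sum_{k=1}^\infty\frac{(k-3)(2k-1)(2k-3)(2k-5)}{2^{2k}(2k)!}\frac{\partial^{2k}f}{\partial p^{2k}}\varrho^k\\&+\frac{20}{27}\varrho^{5/2}\sum_{k=0}^\infty\frac{(k+1)(k+2)}{2^{2k}(2k+5)!}\Big(81\frac{\partial^{2k}\gamma_0}{\partial p^{2k}}-36k\frac{\partial^{2k-1}\beta_0}{\partial p^{2k-1}}+2k(2k-1)\frac{\partial^{2k-2}\alpha_0}{\partial p^{2k-2}}\Big)\varrho^k.\end{aligned}$$ Here $\alpha_0,\beta_0,\gamma_0$ are arbitrary functions of the variables $x,y,p$.
   Context: Subscripts $x,y,p$ denote partial derivatives. Solutions are (formal) series, for $\varrho\ge0$, of the form $A=\sum_{k\ge1}a_k(x,y,p)\varrho^k+\varrho^{5/2}\sum_{k\ge0}\alpha_k(x,y,p)\varrho^k$, $B=\sum_{k\ge1}b_k\varrho^k+\varrho^{5/2}\sum_{k\ge0}\beta_k\varrho^k$, $C=\sum_{k\ge1}c_k\varrho^k+\varrho^{5/2}\sum_{k\ge0}\gamma_k\varrho^k$ ($0$ and $5/2$ being the exponents annihilated by the $\varrho$-part of $L$). Terms with a negative order of differentiation have coefficient $0$ and are understood to be $0$. *)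

(* Defs.v *)
From Stdlib Require Import Reals List ZArith.
From Coquelicot Require Import Coquelicot.
Open Scope R_scope.

(** * Smooth functions of (x, y, p) on an open set *)

Definition fn3 := R -> R -> R -> R.

Inductive var := Vx | Vy | Vp.

Definition pd (v : var) (u : fn3) : fn3 :=
  match v with
  | Vx => fun x y p => Derive (fun t => u t y p) x
  | Vy => fun x y p => Derive (fun t => u x t p) y
  | Vp => fun x y p => Derive (fun t => u x y t) p
  end.

Definition ex_pd (v : var) (u : fn3) (x y p : R) : Prop :=
  match v with
  | Vx => ex_derive (fun t => u t y p) x
  | Vy => ex_derive (fun t => u x t p) y
  | Vp => ex_derive (fun t => u x y t) p
  end.

Definition pds (w : list var) (u : fn3) : fn3 := fold_right pd u w.

(** [C^oo] on [D]: all iterated partial derivatives, in any order, exist and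
    are (jointly) continuous at every point of [D]. *)
Definition smooth_on (D : R * R * R -> Prop) (u : fn3) : Prop :=
  forall (w : list var) (x y p : R), D (x, y, p) ->
    (forall v : var, ex_pd v (pds w u) x y p) /\
    continuous (fun q : R * R * R => pds w u (fst (fst q)) (snd (fst q)) (snd q))
               (x, y, p).

Definition dp (n : nat) (u : fn3) : fn3 :=
  fun x y p => Derive_n (fun t => u x y t) n p.

(** A function [h(x,y)], viewed as a function of (x, y, p). *)
Definition lift (h : R -> R -> R) : fn3 := fun x y _ => h x y.

(** * Formal series in half-integer powers of rho *)

(** [s n] is the coefficient of [rho^(n/2)]. *)
Definition fser := Z -> fn3.

Definition fser_eq_on (D : R * R * R -> Prop) (s t : fser) : Prop :=
  forall (n : Z) (x y p : R), D (x, y, p) -> s n x y p = t n x y p.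

(** The series [u rho^0]. *)
Definition rho_const (u : fn3) : fser :=
  fun n x y p => if Z.eqb n 0 then u x y p else 0.

Definition rho_mul (s : fser) : fser := fun n => s (n - 2)%Z.

(** [d/drho rho^(m/2) = (m/2) rho^((m-2)/2)], with [m = n + 2]. *)
Definition rho_D (s : fser) : fser :=
  fun n x y p => IZR (n + 2) / 2 * s (n + 2)%Z x y p.

Definition fser_p (s : fser) : fser := fun n => pd Vp (s n).

Definition fser_add (s t : fser) : fser :=
  fun n x y p => s n x y p + t n x y p.

(** [sum_(k >= 1) a_k rho^k + rho^(5/2) sum_(k >= 0) al_k rho^k]
    (the value [a 0] is not used: the series vanishes at [rho = 0]). *)
Definition rho_series (a al : nat -> fn3) : fser :=
  fun n x y p =>
    if Z.even n
    then (if Z.leb 2 n then a (Z.to_nat (n / 2)) x y p else 0)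
    else (if Z.leb 5 n then al (Z.to_nat ((n - 5) / 2)) x y p else 0).

Definition admissible (D : R * R * R -> Prop) (s : fser) : Prop :=
  exists a al : nat -> fn3,
    (forall k, smooth_on D (a k)) /\ (forall k, smooth_on D (al k)) /\
    fser_eq_on D s (rho_series a al).

(** * The linear system *)

Definition L (s : fser) : fser :=
  fun n x y p =>
    2 * rho_mul (rho_D (rho_D s)) n x y p - 3 * rho_D s n x y p
    - 1 / 8 * fser_p (fser_p s) n x y p.

Definition solves_system (D : R * R * R -> Prop) (f : fn3) (h : R -> R -> R)
    (A B C : fser) : Prop :=
  fser_eq_on D (L A)
    (rho_const (fun x y p => 9 / 40 * dp 4 f x y p)) /\
  fser_eq_on D (L B)
    (fun n x y p =>
       - (1 / 36) * fser_p A n x y p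
       + rho_const (fun x y p =>
           3 / 40 * dp 3 f x y p + 9 / 20 * pd Vy (lift h) x y p) n x y p) /\
  fser_eq_on D (L C)
    (fun n x y p =>
       - (1 / 18) * fser_p B n x y p + 1 / 324 * A n x y p
       + rho_const (fun x y p =>
           1 / 30 * dp 2 f x y p - 2 / 15 * h x y ^ 2
           + 1 / 5 * (p * pd Vy (lift h) x y p + pd Vx (lift h) x y p)) n x y p).

(** * The explicit solutions *)

(** In [sol_B] and [sol_C] the truncated orders [2*k-1], [2*k-2] differ from the
    true ones only where these are negative, and there the coefficient is 0. *)

Definition sol_A (f al0 : fn3) : fser :=
  rho_series
    (fun k x y p =>
       3 / 5 * ((2 * INR k - 1) * (2 * INR k - 3)
                / (2 ^ (2 * k) * INR (fact (2 * k))))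
       * dp (2 * k + 2) f x y p)
    (fun k x y p =>
       60 * ((INR k + 2) * (INR k + 1)
             / (2 ^ (2 * k) * INR (fact (2 * k + 5))))
       * dp (2 * k) al0 x y p).

Definition sol_B (f : fn3) (h : R -> R -> R) (al0 be0 : fn3) : fser :=
  fser_add
    (rho_mul (rho_const (fun x y p => - (3 / 20) * pd Vy (lift h) x y p)))
    (rho_series
       (fun k x y p =>
          - (1 / 15) * ((2 * INR k - 1) * (2 * INR k - 3) * (2 * INR k - 5)
                        / (2 ^ (2 * k) * INR (fact (2 * k))))
          * dp (2 * k + 1) f x y p)
       (fun k x y p =>
          20 / 3 * ((INR k + 1) * (INR k + 2)
                    / (2 ^ (2 * k) * INR (fact (2 * k + 5))))
          * (9 * dp (2 * k) be0 x y p
             - 2 * INR k * dp (2 * k - 1) al0 x y p))).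

Definition sol_C (f : fn3) (h : R -> R -> R) (al0 be0 ga0 : fn3) : fser :=
  fser_add
    (rho_mul (rho_const (fun x y p =>
       2 / 45 * h x y ^ 2
       - 1 / 15 * (p * pd Vy (lift h) x y p + pd Vx (lift h) x y p))))
    (rho_series
       (fun k x y p =>
          2 / 135 * ((INR k - 3) * (2 * INR k - 1) * (2 * INR k - 3)
                     * (2 * INR k - 5)
                     / (2 ^ (2 * k) * INR (fact (2 * k))))
          * dp (2 * k) f x y p)
       (fun k x y p =>
          20 / 27 * ((INR k + 1) * (INR k + 2)
                     / (2 ^ (2 * k) * INR (fact (2 * k + 5))))
          * (81 * dp (2 * k) ga0 x y p
             - 36 * INR k * dp (2 * k - 1) be0 x y p
             + 2 * INR k * (2 * INR k - 1) * dp (2 * k - 2) al0 x y p))).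

(* Main.v *)
(** On the coefficient of [rho^(m/2)], the [rho]-part of [L] is multiplication by
    [m (m - 5) / 2].  An admissible series vanishes for [m <= 1] and [m = 3], so by
    induction on [m] in steps of 2 it is determined by its image under [L] together
    with its coefficient at [m = 5].  Hence it suffices that the explicit series
    satisfy the recursions between consecutive coefficients and have
    [rho^(5/2)]-coefficients [al0], [be0], [ga0]. *)
(* [Defs] comes last because [Lra] also exports a name [var]. *)
From Stdlib Require Import Reals List ZArith Lia Lra.
From Coquelicot Require Import Coquelicot.
Require Import Defs.
Open Scope R_scope.

Definition eq_on (D : R * R * R -> Prop) (u v : fn3) : Prop :=
  forall x y p : R, D (x, y, p) -> u x y p = v x y p.

(** * Partial derivatives on an open set *)

(** Balls of the product space are products of balls, so moving one coordinate slightly while the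
    others stay at their centres does not leave [D]. *)
Lemma open_slice (D : R * R * R -> Prop) (x y p : R) :
  open D -> D (x, y, p) ->
  locally x (fun t => D (t, y, p)) /\ locally y (fun t => D (x, t, p)) /\
  locally p (fun t => D (x, y, t)).
Proof.
  intros hD Hq.
  destruct (hD _ Hq) as [e He].
  split; [|split]; exists e; intros t Ht; apply He;
    repeat split; simpl; auto; apply ball_center.
Qed.

(** A derivative at a point of [D] depends only on values along a short slice, which lies in [D]
    because [D] is open. *)
Lemma pd_ext (D : R * R * R -> Prop) (v : var) (u1 u2 : fn3) :
  open D -> eq_on D u1 u2 -> eq_on D (pd v u1) (pd v u2).
Proof.
  intros hD E x y p Hq.
  destruct (open_slice D x y p hD Hq) as [Hx [Hy Hp]].
  destruct v; apply Derive_ext_loc;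
    [ revert Hx | revert Hy | revert Hp ];
    apply filter_imp; intros t Ht; now apply E.
Qed.

Lemma ex_pd_ext (D : R * R * R -> Prop) (v : var) (u1 u2 : fn3) (x y p : R) :
  open D -> eq_on D u1 u2 -> D (x, y, p) ->
  ex_pd v u1 x y p -> ex_pd v u2 x y p.
Proof.
  intros hD E Hq.
  destruct (open_slice D x y p hD Hq) as [Hx [Hy Hp]].
  destruct v; apply ex_derive_ext_loc;
    [ revert Hx | revert Hy | revert Hp ];
    apply filter_imp; intros t Ht; now apply E.
Qed.

Lemma continuous_ext_on (D : R * R * R -> Prop) (u1 u2 : fn3) (x y p : R) :
  open D -> eq_on D u1 u2 -> D (x, y, p) ->
  continuous (fun q : R * R * R => u1 (fst (fst q)) (snd (fst q)) (snd q)) (x, y, p) ->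
  continuous (fun q : R * R * R => u2 (fst (fst q)) (snd (fst q)) (snd q)) (x, y, p).
Proof.
  intros hD E Hq.
  apply continuous_ext_loc.
  generalize (hD _ Hq).
  apply filter_imp; intros [[x' y'] p'] Hq'; now apply E.
Qed.

(** * Smooth functions *)

(** Since [smooth_on] quantifies over all words of derivatives, smoothness follows from membership
    in a class [P] of differentiable continuous functions stable under [pd]. Stability is asked only
    up to equality on [D], because the differentiation rules are available only there. *)
Lemma smooth_coind (D : R * R * R -> Prop) (P : fn3 -> Prop) :
  open D ->
  (forall u, P u ->
     (forall x y p, D (x, y, p) ->
        (forall v, ex_pd v u x y p) /\
        continuous (fun q : R * R * R => u (fst (fst q)) (snd (fst q)) (snd q))
          (x, y, p)) /\
     (forall v, exists u', P u' /\ eq_on D u' (pd v u))) ->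
  forall u, P u -> smooth_on D u.
Proof.
  intros hD HP u Hu.
  assert (Hw : forall w, exists u', P u' /\ eq_on D u' (pds w u)).
  { induction w as [|v w [u' [Pu' E]]].
    - exists u; split; [exact Hu | intros x y p _; reflexivity].
    - destruct (HP u' Pu') as [_ Hd].
      destruct (Hd v) as [u'' [Pu'' E']].
      exists u''; split; [exact Pu''|].
      intros x y p Hq.
      rewrite (E' x y p Hq).
      now apply (pd_ext D v u' (pds w u) hD E). }
  intros w x y p Hq.
  destruct (Hw w) as [u' [Pu' E]].
  destruct (HP u' Pu') as [H _].
  destruct (H x y p Hq) as [H1 H2].
  split.
  - intros v; now apply (ex_pd_ext D v u').
  - now apply (continuous_ext_on D u').
Qed.

Lemma smooth_ext (D : R * R * R -> Prop) (u v : fn3) :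
  open D -> eq_on D u v -> smooth_on D u -> smooth_on D v.
Proof.
  intros hD E Hu.
  assert (Ew : forall w, eq_on D (pds w u) (pds w v)).
  { induction w as [|i w IH]; [exact E | now apply pd_ext]. }
  intros w x y p Hq.
  destruct (Hu w x y p Hq) as [H1 H2].
  split.
  - intros i; now apply (ex_pd_ext D i (pds w u)).
  - now apply (continuous_ext_on D (pds w u)).
Qed.

Lemma smooth_pd (D : R * R * R -> Prop) (v : var) (u : fn3) :
  smooth_on D u -> smooth_on D (pd v u).
Proof.
  intros Hu w.
  (* [fold_right] applies the last letter of the word first, so the inner derivative is appended at
     the end. *)
  replace (pds w (pd v u)) with (pds (w ++ v :: nil) u);
    [apply Hu | unfold pds; now rewrite fold_right_app].
Qed.

Lemma smooth_dp (D : R * R * R -> Prop) (n : nat) (u : fn3) :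
  smooth_on D u -> smooth_on D (dp n u).
Proof.
  (* [Derive_n] adds each new derivative on the outside, so [dp (S n) u] is convertible to
     [pd Vp (dp n u)]. *)
  intros Hu; induction n as [|n IH]; [exact Hu | exact (smooth_pd D Vp _ IH)].
Qed.

(** Stable under [pd] by the sum and Leibniz rules, as [smooth_coind] requires. *)
Inductive smooth_alg (D : R * R * R -> Prop) : fn3 -> Prop :=
| Alg_smooth u : smooth_on D u -> smooth_alg D u
| Alg_const (c : R) : smooth_alg D (fun _ _ _ => c)
| Alg_p : smooth_alg D (fun _ _ p => p)
| Alg_plus u v : smooth_alg D u -> smooth_alg D v ->
    smooth_alg D (fun x y p => u x y p + v x y p)
| Alg_mult u v : smooth_alg D u -> smooth_alg D v ->
    smooth_alg D (fun x y p => u x y p * v x y p).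

(** Both requirements of [smooth_coind] are proved in one induction: the sum and Leibniz rules that
    produce a derivative inside the algebra need differentiability of the parts. *)
Lemma smooth_alg_smooth (D : R * R * R -> Prop) (u : fn3) :
  open D -> smooth_alg D u -> smooth_on D u.
Proof.
  intros hD; revert u.
  apply (smooth_coind D (smooth_alg D) hD).
  intros u Hu; induction Hu as [u Hu|c| |u1 u2 H1 [I1 J1] H2 [I2 J2]
                               |u1 u2 H1 [I1 J1] H2 [I2 J2]].
  - split.
    + intros x y p Hq; exact (Hu nil x y p Hq).
    + intros v; exists (pd v u); split;
        [now apply Alg_smooth, smooth_pd | intros x y p _; reflexivity].
  - split.
    + intros x y p _; split; [|apply continuous_const].
      intros []; simpl; auto_derive; exact I.
    + intros v; exists (fun _ _ _ => 0); split; [apply Alg_const|].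
      intros x y p _; destruct v; simpl; now rewrite Derive_const.
  - split.
    + intros x y p _; split; [|apply continuous_snd].
      intros []; simpl; auto_derive; exact I.
    + intros v; exists (fun _ _ _ => match v with Vp => 1 | _ => 0 end);
        split; [apply Alg_const|].
      intros x y p _; destruct v; simpl;
        [now rewrite Derive_const | now rewrite Derive_const | now rewrite Derive_id].
  - split.
    + intros x y p Hq.
      destruct (I1 x y p Hq) as [E1 C1], (I2 x y p Hq) as [E2 C2].
      split; [|exact (continuous_plus _ _ _ C1 C2)].
      intros v; generalize (E1 v) (E2 v); destruct v;
        exact (ex_derive_plus _ _ _).
    + intros v; destruct (J1 v) as [v1 [K1 L1]], (J2 v) as [v2 [K2 L2]].
      exists (fun x y p => v1 x y p + v2 x y p); split; [now apply Alg_plus|].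
      intros x y p Hq; rewrite (L1 x y p Hq), (L2 x y p Hq); symmetry.
      destruct (I1 x y p Hq) as [E1 _], (I2 x y p Hq) as [E2 _].
      generalize (E1 v) (E2 v); destruct v; exact (Derive_plus _ _ _).
  - split.
    + intros x y p Hq.
      destruct (I1 x y p Hq) as [E1 C1], (I2 x y p Hq) as [E2 C2].
      split; [|exact (continuous_mult _ _ _ C1 C2)].
      intros v; generalize (E1 v) (E2 v); destruct v;
        exact (ex_derive_mult _ _ _).
    + intros v; destruct (J1 v) as [v1 [K1 L1]], (J2 v) as [v2 [K2 L2]].
      exists (fun x y p => v1 x y p * u2 x y p + u1 x y p * v2 x y p); split;
        [apply Alg_plus; now apply Alg_mult|].
      intros x y p Hq; rewrite (L1 x y p Hq), (L2 x y p Hq); symmetry.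
      destruct (I1 x y p Hq) as [E1 _], (I2 x y p Hq) as [E2 _].
      generalize (E1 v) (E2 v); destruct v; exact (Derive_mult _ _ _).
Qed.

Lemma smooth_const (D : R * R * R -> Prop) (c : R) :
  open D -> smooth_on D (fun _ _ _ => c).
Proof. intros hD; apply smooth_alg_smooth, Alg_const; exact hD. Qed.

Lemma smooth_p (D : R * R * R -> Prop) :
  open D -> smooth_on D (fun _ _ p => p).
Proof. intros hD; apply smooth_alg_smooth, Alg_p; exact hD. Qed.

Lemma smooth_plus (D : R * R * R -> Prop) (u v : fn3) :
  open D -> smooth_on D u -> smooth_on D v ->
  smooth_on D (fun x y p => u x y p + v x y p).
Proof.
  intros hD Hu Hv; apply smooth_alg_smooth; [exact hD|].
  apply Alg_plus; now apply Alg_smooth.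
Qed.

Lemma smooth_mult (D : R * R * R -> Prop) (u v : fn3) :
  open D -> smooth_on D u -> smooth_on D v ->
  smooth_on D (fun x y p => u x y p * v x y p).
Proof.
  intros hD Hu Hv; apply smooth_alg_smooth; [exact hD|].
  apply Alg_mult; now apply Alg_smooth.
Qed.

Lemma smooth_minus (D : R * R * R -> Prop) (u v : fn3) :
  open D -> smooth_on D u -> smooth_on D v ->
  smooth_on D (fun x y p => u x y p - v x y p).
Proof.
  intros hD Hu Hv.
  apply (smooth_ext D (fun x y p => u x y p + (-1) * v x y p) _ hD).
  - intros x y p _; ring.
  - apply (smooth_plus D u); auto.
    apply (smooth_mult D (fun _ _ _ => -1)); auto using smooth_const.
Qed.

Lemma smooth_if (D : R * R * R -> Prop) (b : bool) (u v : fn3) :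
  smooth_on D u -> smooth_on D v ->
  smooth_on D (fun x y p => if b then u x y p else v x y p).
Proof. now destruct b. Qed.

(** * Derivatives in [p] *)

(** The relational form lets the derivative be built by applying rules, each carrying its own proof
    of differentiability. *)
Definition is_dp (D : R * R * R -> Prop) (u u' : fn3) : Prop :=
  forall x y p : R, D (x, y, p) -> is_derive (fun t => u x y t) p (u' x y p).

Lemma is_dp_pd (D : R * R * R -> Prop) (u u' : fn3) :
  is_dp D u u' -> eq_on D (pd Vp u) u'.
Proof. intros H x y p Hq; exact (is_derive_unique _ _ _ (H x y p Hq)). Qed.

Lemma is_dp_pd2 (D : R * R * R -> Prop) (u u' u'' : fn3) :
  open D -> is_dp D u u' -> is_dp D u' u'' -> eq_on D (pd Vp (pd Vp u)) u''.
Proof.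
  intros hD H H' x y p Hq.
  rewrite (pd_ext D Vp _ _ hD (is_dp_pd D u u' H) x y p Hq).
  now apply (is_dp_pd D).
Qed.

Lemma is_dp_dp (D : R * R * R -> Prop) (u : fn3) (n : nat) :
  smooth_on D u -> is_dp D (dp n u) (dp (S n) u).
Proof.
  intros Hu x y p Hq.
  apply (Derive_correct (fun t => dp n u x y t)).
  exact (proj1 (smooth_dp D n u Hu nil x y p Hq) Vp).
Qed.

Lemma is_dp_scal (D : R * R * R -> Prop) (c : R) (u u' : fn3) :
  is_dp D u u' ->
  is_dp D (fun x y p => c * u x y p) (fun x y p => c * u' x y p).
Proof. intros H x y p Hq; exact (is_derive_scal _ p c _ (H x y p Hq)). Qed.

Lemma is_dp_plus (D : R * R * R -> Prop) (u u' v v' : fn3) :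
  is_dp D u u' -> is_dp D v v' ->
  is_dp D (fun x y p => u x y p + v x y p) (fun x y p => u' x y p + v' x y p).
Proof.
  intros H1 H2 x y p Hq; exact (is_derive_plus _ _ p _ _ (H1 x y p Hq) (H2 x y p Hq)).
Qed.

Lemma is_dp_minus (D : R * R * R -> Prop) (u u' v v' : fn3) :
  is_dp D u u' -> is_dp D v v' ->
  is_dp D (fun x y p => u x y p - v x y p) (fun x y p => u' x y p - v' x y p).
Proof.
  intros H1 H2 x y p Hq; exact (is_derive_minus _ _ p _ _ (H1 x y p Hq) (H2 x y p Hq)).
Qed.

Lemma is_dp_const (D : R * R * R -> Prop) (g : R -> R -> R) :
  is_dp D (fun x y _ => g x y) (fun _ _ _ => 0).
Proof. intros x y p _; exact (is_derive_const (g x y) p). Qed.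

Lemma is_dp_if (D : R * R * R -> Prop) (b : bool) (u u' v v' : fn3) :
  is_dp D u u' -> is_dp D v v' ->
  is_dp D (fun x y p => if b then u x y p else v x y p)
    (fun x y p => if b then u' x y p else v' x y p).
Proof. now destruct b. Qed.

(** Serves the only term of the explicit solutions with an explicit factor [p], namely [p h_y] in
    [sol_C]. *)
Lemma is_dp_affine (D : R * R * R -> Prop) (g : R -> R -> R) :
  is_dp D (fun x y p => p * g x y) (fun x y _ => g x y).
Proof. intros x y p _; auto_derive; [exact I | ring]. Qed.

(** * Formal series *)

(** The cases follow [rho_series]: positive integer powers, half-integer powers from [rho^(5/2)] on,
    and the indices where the series vanishes. *)
Lemma index_cases (n : Z) :
  (exists k : nat, n = 2 * Z.of_nat (S k))%Z \/
  (exists k : nat, n = 2 * Z.of_nat k + 5)%Z \/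
  (n <= 0)%Z \/ n = 1%Z \/ n = 3%Z.
Proof.
  destruct (Z_lt_le_dec 0 n) as [Hn|Hn]; [|now right; right; left].
  destruct (Z.Even_or_Odd n) as [[m Hm]|[m Hm]].
  - left; exists (Z.to_nat (m - 1)); lia.
  - right.
    destruct (Z_lt_le_dec m 2) as [H2|H2]; [right; lia|].
    left; exists (Z.to_nat (m - 2)); lia.
Qed.

Lemma rho_series_even (a al : nat -> fn3) (k : nat) :
  rho_series a al (2 * Z.of_nat (S k))%Z = a (S k).
Proof.
  unfold rho_series.
  rewrite Z.even_mul.
  replace (2 * Z.of_nat (S k) / 2)%Z with (Z.of_nat (S k))
    by (rewrite Z.mul_comm, Z.div_mul; lia).
  replace (Z.leb 2 (2 * Z.of_nat (S k))) with true by (symmetry; apply Z.leb_le; lia).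
  now rewrite Nat2Z.id.
Qed.

Lemma rho_series_odd (a al : nat -> fn3) (k : nat) :
  rho_series a al (2 * Z.of_nat k + 5)%Z = al k.
Proof.
  unfold rho_series.
  rewrite Z.even_add, Z.even_mul.
  replace ((2 * Z.of_nat k + 5 - 5) / 2)%Z with (Z.of_nat k)
    by (replace (2 * Z.of_nat k + 5 - 5)%Z with (Z.of_nat k * 2)%Z by ring;
        rewrite Z.div_mul; lia).
  replace (Z.leb 5 (2 * Z.of_nat k + 5)) with true by (symmetry; apply Z.leb_le; lia).
  now rewrite Nat2Z.id.
Qed.

Lemma rho_series_zero (a al : nat -> fn3) (n : Z) :
  (n <= 0 \/ n = 1 \/ n = 3)%Z -> rho_series a al n = fun _ _ _ => 0.
Proof.
  intros [H|[->| ->]]; [|reflexivity|reflexivity].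
  unfold rho_series.
  replace (Z.leb 2 n) with false by (symmetry; apply Z.leb_gt; lia).
  replace (Z.leb 5 n) with false by (symmetry; apply Z.leb_gt; lia).
  now destruct (Z.even n).
Qed.

Lemma rho_series_scal (c : R) (a al : nat -> fn3) (n : Z) (x y p : R) :
  c * rho_series a al n x y p
  = rho_series (fun k x y p => c * a k x y p) (fun k x y p => c * al k x y p) n x y p.
Proof.
  destruct (index_cases n) as [[k ->]|[[k ->]|H]].
  - now rewrite !rho_series_even.
  - now rewrite !rho_series_odd.
  - rewrite !rho_series_zero by exact H; ring.
Qed.

Lemma rho_series_plus (a al b be : nat -> fn3) (n : Z) (x y p : R) :
  rho_series a al n x y p + rho_series b be n x y p
  = rho_series (fun k x y p => a k x y p + b k x y p)
      (fun k x y p => al k x y p + be k x y p) n x y p.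
Proof.
  destruct (index_cases n) as [[k ->]|[[k ->]|H]].
  - now rewrite !rho_series_even.
  - now rewrite !rho_series_odd.
  - rewrite !rho_series_zero by exact H; ring.
Qed.

Lemma rho_const_neq (u : fn3) (n : Z) (x y p : R) :
  n <> 0%Z -> rho_const u n x y p = 0.
Proof. intros H; unfold rho_const; now rewrite (proj2 (Z.eqb_neq n 0) H). Qed.

Lemma pd_zero (v : var) (x y p : R) : pd v (fun _ _ _ => 0) x y p = 0.
Proof. destruct v; simpl; apply Derive_const. Qed.

Lemma fser_p_rho_series (a al : nat -> fn3) (n : Z) (x y p : R) :
  fser_p (rho_series a al) n x y p
  = rho_series (fun k => pd Vp (a k)) (fun k => pd Vp (al k)) n x y p.
Proof.
  unfold fser_p.
  destruct (index_cases n) as [[k ->]|[[k ->]|H]].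
  - now rewrite !rho_series_even.
  - now rewrite !rho_series_odd.
  - rewrite !rho_series_zero by exact H; apply pd_zero.
Qed.

Lemma fser_p_ext (D : R * R * R -> Prop) (s t : fser) :
  open D -> fser_eq_on D s t -> fser_eq_on D (fser_p s) (fser_p t).
Proof. intros hD E n; apply pd_ext; [exact hD | exact (E n)]. Qed.

(** * Action of [L] on coefficients, and uniqueness *)

Lemma L_coef (s : fser) (n : Z) (x y p : R) :
  L s n x y p = IZR (n + 2) * IZR (n - 3) / 2 * s (n + 2)%Z x y p
                - 1 / 8 * pd Vp (pd Vp (s n)) x y p.
Proof.
  unfold L, rho_mul, rho_D, fser_p.
  replace (n - 2 + 2)%Z with n by ring.
  (* With [m = n + 2], the factor is [2 (m/2) (m/2 - 1) - 3 m/2 = m (m - 5) / 2]. *)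
  rewrite plus_IZR, minus_IZR; field.
Qed.

Lemma L_ext (D : R * R * R -> Prop) (s t : fser) :
  open D -> fser_eq_on D s t -> fser_eq_on D (L s) (L t).
Proof.
  intros hD E n x y p Hq.
  rewrite !L_coef, (E _ x y p Hq).
  now rewrite (pd_ext D Vp _ _ hD (pd_ext D Vp _ _ hD (E n)) x y p Hq).
Qed.

Lemma rho_series_unique (D : R * R * R -> Prop) (a al b be : nat -> fn3) :
  open D ->
  fser_eq_on D (L (rho_series a al)) (L (rho_series b be)) ->
  eq_on D (al 0%nat) (be 0%nat) ->
  fser_eq_on D (rho_series a al) (rho_series b be).
Proof.
  intros hD E E0.
  (* The excluded values are those where [n + 2] is a root 0 or 5 of the indicial factor; elsewhere
     one can divide by it. *)
  assert (step : forall n, n <> (-2)%Z -> n <> 3%Z ->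
    eq_on D (rho_series a al n) (rho_series b be n) ->
    eq_on D (rho_series a al (n + 2)%Z) (rho_series b be (n + 2)%Z)).
  { intros n N1 N2 En x y p Hq.
    generalize (E n x y p Hq); rewrite !L_coef.
    rewrite (pd_ext D Vp _ _ hD (pd_ext D Vp _ _ hD En) x y p Hq).
    intros H.
    apply (Rmult_eq_reg_l (IZR (n + 2) * IZR (n - 3) / 2)); [lra|].
    assert (IZR (n + 2) <> 0) by (apply not_0_IZR; lia).
    assert (IZR (n - 3) <> 0) by (apply not_0_IZR; lia).
    apply Rmult_integral_contrapositive_currified; [|lra].
    now apply Rmult_integral_contrapositive_currified. }
  intros n.
  change (eq_on D (rho_series a al n) (rho_series b be n)).
  (* The even chain starts from the zero coefficient at index 0, the odd chain from index 5, where
     agreement is [E0]. *)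
  destruct (index_cases n) as [[k ->]|[[k ->]|H]].
  - induction k as [|k IH].
    + apply (step 0%Z); [lia | lia |].
      rewrite !rho_series_zero by lia; intros x y p _; reflexivity.
    + replace (2 * Z.of_nat (S (S k)))%Z with (2 * Z.of_nat (S k) + 2)%Z by lia.
      apply step; [lia | lia | exact IH].
  - induction k as [|k IH].
    + now rewrite !rho_series_odd.
    + replace (2 * Z.of_nat (S k) + 5)%Z with (2 * Z.of_nat k + 5 + 2)%Z by lia.
      apply step; [lia | lia | exact IH].
  - rewrite !rho_series_zero by exact H; intros x y p _; reflexivity.
Qed.

Lemma admissible_unique (D : R * R * R -> Prop) (s t : fser) :
  open D -> admissible D s -> admissible D t ->
  fser_eq_on D (L s) (L t) -> eq_on D (s 5%Z) (t 5%Z) -> fser_eq_on D s t.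
Proof.
  intros hD [a [al [_ [_ Es]]]] [b [be [_ [_ Et]]]] E E5.
  assert (H : fser_eq_on D (rho_series a al) (rho_series b be)).
  { apply rho_series_unique; [exact hD | |].
    - intros n x y p Hq.
      rewrite <- (L_ext D _ _ hD Es n x y p Hq), <- (L_ext D _ _ hD Et n x y p Hq).
      now apply E.
    - intros x y p Hq.
      transitivity (s 5%Z x y p); [symmetry; exact (Es 5%Z x y p Hq)|].
      rewrite (E5 x y p Hq); exact (Et 5%Z x y p Hq). }
  intros n x y p Hq.
  rewrite (Es n x y p Hq), (Et n x y p Hq); now apply H.
Qed.

Lemma admissible_ext (D : R * R * R -> Prop) (s t : fser) :
  fser_eq_on D s t -> admissible D t -> admissible D s.
Proof.
  intros E [a [al [Ha [Hal Et]]]].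
  exists a, al; split; [exact Ha | split; [exact Hal|]].
  intros n x y p Hq; rewrite (E n x y p Hq); now apply Et.
Qed.

(** Turns an equation for [L] into recursions. The factors are [(n + 2)(n - 3)/2] at [n = 0],
    [n = 2(k + 1)] and [n = 2k + 5]; the constant [u] enters only at [n = 0]. *)
Lemma L_rho_series (D : R * R * R -> Prop) (a al r rh : nat -> fn3) (u : fn3) :
  eq_on D (fun x y p => -3 * a 1%nat x y p) u ->
  (forall k, eq_on D
     (fun x y p => (INR k + 2) * (2 * INR k - 1) * a (S (S k)) x y p
                   - 1 / 8 * pd Vp (pd Vp (a (S k))) x y p) (r (S k))) ->
  (forall k, eq_on D
     (fun x y p => (2 * INR k + 7) * (INR k + 1) * al (S k) x y p
                   - 1 / 8 * pd Vp (pd Vp (al k)) x y p) (rh k)) ->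
  fser_eq_on D (L (rho_series a al))
    (fun n x y p => rho_series r rh n x y p + rho_const u n x y p).
Proof.
  intros H0 Ha Hal n x y p Hq; rewrite L_coef.
  destruct (index_cases n) as [[k ->]|[[k ->]|H]].
  - rewrite rho_const_neq by lia.
    rewrite !rho_series_even, <- (Ha k x y p Hq).
    replace (2 * Z.of_nat (S k) + 2)%Z with (2 * Z.of_nat (S (S k)))%Z by lia.
    rewrite rho_series_even, minus_IZR, !mult_IZR, <- !INR_IZR_INZ, !S_INR; field.
  - rewrite rho_const_neq by lia.
    rewrite !rho_series_odd, <- (Hal k x y p Hq).
    replace (2 * Z.of_nat k + 5 + 2)%Z with (2 * Z.of_nat (S k) + 5)%Z by lia.
    rewrite rho_series_odd, minus_IZR, !plus_IZR, !mult_IZR, <- !INR_IZR_INZ, !S_INR;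
      field.
  - rewrite !(rho_series_zero _ _ n) by exact H.
    (* The inner derivative must first be replaced by the zero function on the whole space before
       the outer one can be computed. *)
    rewrite (pd_ext (fun _ => True) Vp _ (fun _ _ _ => 0) open_true
              (fun x y p _ => pd_zero Vp x y p) x y p I), pd_zero.
    destruct (Z.eq_dec n 0) as [->|N0].
    + change (0 + 2)%Z with (2 * Z.of_nat 1)%Z; rewrite rho_series_even.
      unfold rho_const; simpl (Z.eqb 0 0); cbv iota.
      rewrite <- (H0 x y p Hq); simpl; field.
    + rewrite rho_const_neq by exact N0.
      destruct (Z.eq_dec n (-2)) as [->|N2]; [simpl; field|].
      (* Here the free coefficient at index 5 appears, with the vanishing factor [n - 3]. *)
      destruct (Z.eq_dec n 3) as [->|N3]; [simpl; field|].
      rewrite rho_series_zero by lia; ring.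
Qed.

(** Absorbing the isolated [rho] term into the coefficient of index 1 brings [sol_B] and [sol_C]
    under the lemmas on [rho_series]. *)
Lemma fser_add_rho (e : fn3) (a al : nat -> fn3) (n : Z) (x y p : R) :
  fser_add (rho_mul (rho_const e)) (rho_series a al) n x y p
  = rho_series
      (fun k x y p => (if Nat.eqb k 1 then e x y p else 0) + a k x y p) al n x y p.
Proof.
  unfold fser_add, rho_mul.
  destruct (index_cases n) as [[k ->]|[[k ->]|H]].
  - rewrite !rho_series_even.
    destruct k as [|k]; [reflexivity|].
    rewrite rho_const_neq by lia; reflexivity.
  - rewrite !rho_series_odd, rho_const_neq by lia; ring.
  - rewrite !rho_series_zero, rho_const_neq by lia; ring.
Qed.

(** * The explicit solutions *)

Ltac smooth_tac :=
  match goal with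
  | |- smooth_on ?D (fun _ _ _ => ?c) => apply (smooth_const D c); assumption
  | |- smooth_on ?D (fun _ _ p => p) => apply (smooth_p D); assumption
  | |- smooth_on ?D (fun x y p => dp ?n ?u x y p) =>
      apply (smooth_dp D n u); assumption
  | |- smooth_on ?D (fun x y p => pd ?v ?u x y p) =>
      apply (smooth_pd D v u); assumption
  | |- smooth_on ?D (fun x y p => @?u x y p + @?v x y p) =>
      apply (smooth_plus D u v); [assumption | smooth_tac | smooth_tac]
  | |- smooth_on ?D (fun x y p => @?u x y p - @?v x y p) =>
      apply (smooth_minus D u v); [assumption | smooth_tac | smooth_tac]
  | |- smooth_on ?D (fun x y p => @?u x y p * @?v x y p) =>
      apply (smooth_mult D u v); [assumption | smooth_tac | smooth_tac]
  | |- smooth_on ?D (fun x y p => if ?b then @?u x y p else @?v x y p) =>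
      apply (smooth_if D b u v); smooth_tac
  | _ => assumption
  end.

Lemma admissible_sol_A (D : R * R * R -> Prop) (f al0 : fn3) :
  open D -> smooth_on D f -> smooth_on D al0 -> admissible D (sol_A f al0).
Proof.
  intros hD hf ha.
  eexists; eexists; split; [|split]; [| | unfold sol_A; intros n x y p _; reflexivity];
    intros k; cbv beta; smooth_tac.
Qed.

Lemma admissible_sol_B (D : R * R * R -> Prop) (f : fn3) (h : R -> R -> R)
    (al0 be0 : fn3) :
  open D -> smooth_on D f -> smooth_on D (lift h) ->
  smooth_on D al0 -> smooth_on D be0 -> admissible D (sol_B f h al0 be0).
Proof.
  intros hD hf hh ha hb.
  eexists; eexists; split; [|split];
    [| | intros n x y p _; apply fser_add_rho]; intros k.
  - cbv beta; smooth_tac.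
  - cbv beta; smooth_tac.
Qed.

Lemma admissible_sol_C (D : R * R * R -> Prop) (f : fn3) (h : R -> R -> R)
    (al0 be0 ga0 : fn3) :
  open D -> smooth_on D f -> smooth_on D (lift h) ->
  smooth_on D al0 -> smooth_on D be0 -> smooth_on D ga0 ->
  admissible D (sol_C f h al0 be0 ga0).
Proof.
  intros hD hf hh ha hb hg.
  assert (hh' : smooth_on D (fun x y _ => h x y)) by exact hh.
  eexists; eexists; split; [|split];
    [| | intros n x y p _; apply fser_add_rho]; intros k.
  (* Unfolding exposes the square of [h] as a product, to which the Leibniz clause applies. *)
  - unfold pow; cbv beta; smooth_tac.
  - cbv beta; smooth_tac.
Qed.

(** The prefactors are normalised for this: at [k = 0] each reduces to [60 * 2 / 5! = 1], since
    [20/3 * 9 = 20/27 * 81 = 60], and the remaining terms carry a factor [k]. *)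
Lemma sol_coef5 (f : fn3) (h : R -> R -> R) (al0 be0 ga0 : fn3) (x y p : R) :
  sol_A f al0 5%Z x y p = al0 x y p /\
  sol_B f h al0 be0 5%Z x y p = be0 x y p /\
  sol_C f h al0 be0 ga0 5%Z x y p = ga0 x y p.
Proof.
  unfold sol_A, sol_B, sol_C; rewrite !fser_add_rho.
  change 5%Z with (2 * Z.of_nat 0 + 5)%Z; rewrite !rho_series_odd.
  unfold dp; simpl; repeat split; field.
Qed.

(** * Recursions satisfied by the explicit coefficients *)

Lemma denominator_even (k : nat) :
  2 ^ (2 * S k) * INR (fact (2 * S k))
  = 8 * (INR k + 1) * (2 * INR k + 1) * (2 ^ (2 * k) * INR (fact (2 * k))).
Proof.
  replace (2 * S k)%nat with (S (S (2 * k))) by lia.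
  rewrite !fact_simpl, !mult_INR, !S_INR, mult_INR, <- !tech_pow_Rmult; simpl (INR 2); ring.
Qed.

Lemma denominator_odd (k : nat) :
  2 ^ (2 * S k) * INR (fact (2 * S k + 5))
  = 8 * (INR k + 3) * (2 * INR k + 7) * (2 ^ (2 * k) * INR (fact (2 * k + 5))).
Proof.
  replace (2 * S k)%nat with (S (S (2 * k))) by lia.
  replace (S (S (2 * k)) + 5)%nat with (S (S (2 * k + 5))) by lia.
  rewrite !fact_simpl, !mult_INR, !S_INR, plus_INR, mult_INR, <- !tech_pow_Rmult;
    simpl (INR 2); simpl (INR 5); ring.
Qed.

Lemma denominator_neq0 (k m : nat) : 2 ^ (2 * k) * INR (fact m) <> 0.
Proof.
  apply Rmult_integral_contrapositive_currified;
    [apply pow_nonzero; lra | apply INR_fact_neq_0].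
Qed.

(** The derivatives of [lift h] have their own clauses because they mention [p] syntactically,
    although their values do not depend on it. *)
Ltac is_dp_tac :=
  match goal with
  | |- is_dp ?D (fun x y p => dp ?n ?u x y p) _ =>
      apply (is_dp_dp D u n); assumption
  | |- is_dp ?D (fun x y p => pd Vx (lift ?h) x y p) _ =>
      apply (is_dp_const D (fun x y => Derive (fun t => h t y) x))
  | |- is_dp ?D (fun x y p => pd Vy (lift ?h) x y p) _ =>
      apply (is_dp_const D (fun x y => Derive (fun t => h x t) y))
  | |- is_dp ?D (fun x y p => p * pd Vy (lift ?h) x y p) _ =>
      apply (is_dp_affine D (fun x y => Derive (fun t => h x t) y))
  | |- is_dp ?D (fun x y _ => @?g x y) _ => apply (is_dp_const D g)
  | |- is_dp ?D (fun x y p => ?c * @?u x y p) _ =>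
      eapply (is_dp_scal D c u); is_dp_tac
  | |- is_dp ?D (fun x y p => @?u x y p + @?v x y p) _ =>
      eapply (is_dp_plus D u _ v); is_dp_tac
  | |- is_dp ?D (fun x y p => @?u x y p - @?v x y p) _ =>
      eapply (is_dp_minus D u _ v); is_dp_tac
  | |- is_dp ?D (fun x y p => if ?b then @?u x y p else @?v x y p) _ =>
      eapply (is_dp_if D b u _ v); is_dp_tac
  end.

(** The common denominator becomes an opaque nonzero [d], leaving a rational identity in the index;
    nonnegativity of [INR j] keeps the other linear denominators nonzero. *)
Ltac recursion_field k m :=
  generalize (denominator_neq0 k m);
  generalize (2 ^ (2 * k) * INR (fact m)); intros d Hd; rewrite ?S_INR, ?INR_0;
  try match goal with |- context [INR ?j] => generalize (pos_INR j); intros Hj end;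
  field; repeat split; try exact Hd; lra.

(** Consecutive coefficients telescope. For integer powers the new numerator factor [2k + 1] cancels
    against the denominator and the indicial factor [(k + 1)(2k - 3)] restores the old numerator,
    leaving [1/8]; for half-integer powers [(2k + 7)(k + 1)] does the same. *)
Lemma L_sol_A (D : R * R * R -> Prop) (f al0 : fn3) :
  open D -> smooth_on D f -> smooth_on D al0 ->
  fser_eq_on D (L (sol_A f al0)) (rho_const (fun x y p => 9 / 40 * dp 4 f x y p)).
Proof.
  intros hD hf ha n x y p Hq.
  unfold sol_A.
  rewrite (L_rho_series D _ _ (fun _ _ _ _ => 0) (fun _ _ _ _ => 0)
             (fun x y p => 9 / 40 * dp 4 f x y p)); [| | | |exact Hq].
  - destruct (index_cases n) as [[k ->]|[[k ->]|H]];
      [rewrite rho_series_even | rewrite rho_series_odd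
      | rewrite rho_series_zero by exact H]; ring.
  - intros x' y' p' _; simpl; field.
  - intros k x' y' p' Hq'; cbv beta.
    erewrite (is_dp_pd2 D); [| exact hD | is_dp_tac | cbv beta; is_dp_tac | exact Hq'].
    cbv beta.
    replace (S (S (2 * S k + 2))) with (2 * S (S k) + 2)%nat by lia.
    rewrite denominator_even.
    recursion_field (S k) (2 * S k)%nat.
  - intros k x' y' p' Hq'; cbv beta.
    erewrite (is_dp_pd2 D); [| exact hD | is_dp_tac | cbv beta; is_dp_tac | exact Hq'].
    cbv beta.
    replace (S (S (2 * k))) with (2 * S k)%nat by lia.
    rewrite denominator_odd.
    recursion_field k (2 * k + 5)%nat.
Qed.

(** The telescoping of [L_sol_A] now leaves a remainder: [(2k - 3) - (2k - 5) = 2] for integer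
    powers and [-2(k + 1) + 2k = -2] for half-integer ones. Both produce [- A_p / 36]. *)
Lemma L_sol_B (D : R * R * R -> Prop) (f : fn3) (h : R -> R -> R) (al0 be0 : fn3) :
  open D -> smooth_on D f -> smooth_on D al0 -> smooth_on D be0 ->
  fser_eq_on D (L (sol_B f h al0 be0))
    (fun n x y p =>
       - (1 / 36) * fser_p (sol_A f al0) n x y p
       + rho_const (fun x y p =>
           3 / 40 * dp 3 f x y p + 9 / 20 * pd Vy (lift h) x y p) n x y p).
Proof.
  intros hD hf ha hb n x y p Hq.
  unfold sol_A, sol_B.
  rewrite (L_ext D _ _ hD (fun n x y p _ => fser_add_rho _ _ _ n x y p) n x y p Hq).
  rewrite fser_p_rho_series, rho_series_scal.
  revert n x y p Hq; apply L_rho_series.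
  - intros x y p _; simpl; field.
  - intros k x y p Hq; cbv beta.
    change (Nat.eqb (S (S k)) 1) with false; cbv iota.
    erewrite (is_dp_pd2 D); [| exact hD | is_dp_tac | cbv beta; is_dp_tac | exact Hq].
    erewrite (is_dp_pd D); [| is_dp_tac | exact Hq].
    cbv beta.
    replace (S (S (2 * S k + 1))) with (2 * S (S k) + 1)%nat by lia.
    replace (S (2 * S k + 2)) with (2 * S (S k) + 1)%nat by lia.
    rewrite denominator_even.
    (* The [h_y] term sits in the coefficient of [rho] and has zero derivative in [p], so both cases
       agree. *)
    destruct (Nat.eqb (S k) 1); recursion_field (S k) (2 * S k)%nat.
  - intros k x y p Hq; cbv beta.
    erewrite (is_dp_pd2 D); [| exact hD | is_dp_tac | cbv beta; is_dp_tac | exact Hq].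
    erewrite (is_dp_pd D); [| is_dp_tac | exact Hq].
    cbv beta.
    rewrite denominator_odd.
    replace (S (S (2 * k))) with (2 * S k)%nat by lia.
    replace (2 * S k - 1)%nat with (S (2 * k)) by lia.
    (* At [k = 0] the order [2k - 1] truncates to 0 and differentiation does not give the expected
       order, but the factor [k] removes the term. *)
    destruct k as [|k].
    + recursion_field 0%nat (2 * 0 + 5)%nat.
    + replace (S (S (2 * S k - 1))) with (S (2 * S k)) by lia.
      recursion_field (S k) (2 * S k + 5)%nat.
Qed.

(** For integer powers the remainder is [(k - 2)(2k - 3) - (k - 3)(2k - 5) = 2(2k - 5) + 1], whose
    two parts match [B_p] and [A]. For half-integer powers the [al0] terms leave
    [2(k + 1)(2k + 1) - 2k(2k - 1) = 8k + 2], split in the same way. *)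
Lemma L_sol_C (D : R * R * R -> Prop) (f : fn3) (h : R -> R -> R)
    (al0 be0 ga0 : fn3) :
  open D -> smooth_on D f -> smooth_on D al0 -> smooth_on D be0 -> smooth_on D ga0 ->
  fser_eq_on D (L (sol_C f h al0 be0 ga0))
    (fun n x y p =>
       - (1 / 18) * fser_p (sol_B f h al0 be0) n x y p + 1 / 324 * sol_A f al0 n x y p
       + rho_const (fun x y p =>
           1 / 30 * dp 2 f x y p - 2 / 15 * h x y ^ 2
           + 1 / 5 * (p * pd Vy (lift h) x y p + pd Vx (lift h) x y p)) n x y p).
Proof.
  intros hD hf ha hb hg n x y p Hq.
  unfold sol_A, sol_B, sol_C.
  rewrite (L_ext D _ _ hD (fun n x y p _ => fser_add_rho _ _ _ n x y p) n x y p Hq).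
  rewrite (fser_p_ext D _ _ hD (fun n x y p _ => fser_add_rho _ _ _ n x y p) n x y p Hq).
  rewrite fser_p_rho_series, !rho_series_scal, rho_series_plus.
  revert n x y p Hq; apply L_rho_series.
  - intros x y p _; simpl; field.
  - intros k x y p Hq; cbv beta.
    change (Nat.eqb (S (S k)) 1) with false; cbv iota.
    erewrite (is_dp_pd2 D); [| exact hD | is_dp_tac | cbv beta; is_dp_tac | exact Hq].
    erewrite (is_dp_pd D); [| is_dp_tac | exact Hq].
    cbv beta.
    replace (S (S (2 * S k))) with (2 * S k + 2)%nat by lia.
    replace (S (2 * S k + 1)) with (2 * S k + 2)%nat by lia.
    (* The third occurrence is the order of the derivative; the first two stay in the denominator,
       in the form [denominator_even] expects. *)
    replace (2 * S (S k))%nat with (2 * S k + 2)%nat at 3 by lia.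
    rewrite denominator_even.
    (* The extra [rho] term of [sol_C] is affine in [p] and that of [sol_B] is independent of [p],
       so neither survives the derivatives taken here. *)
    destruct (Nat.eqb (S k) 1); recursion_field (S k) (2 * S k)%nat.
  - intros k x y p Hq; cbv beta.
    erewrite (is_dp_pd2 D); [| exact hD | is_dp_tac | cbv beta; is_dp_tac | exact Hq].
    erewrite (is_dp_pd D); [| is_dp_tac | exact Hq].
    cbv beta.
    rewrite denominator_odd.
    replace (S (S (2 * k))) with (2 * S k)%nat by lia.
    replace (2 * S k - 1)%nat with (S (2 * k)) by lia.
    replace (2 * S k - 2)%nat with (2 * k)%nat by lia.
    (* Both [2k - 1] and [2k - 2] truncate at [k = 0], where their terms have the factor [k]. *)
    destruct k as [|k].
    + recursion_field 0%nat (2 * 0 + 5)%nat.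
    + replace (S (S (2 * S k - 1))) with (S (2 * S k)) by lia.
      replace (S (2 * S k - 1)) with (2 * S k)%nat by lia.
      replace (S (S (2 * S k - 2))) with (2 * S k)%nat by lia.
      recursion_field (S k) (2 * S k + 5)%nat.
Qed.

(** * The general solution of the system *)

Theorem theorem3p6 (D : R * R * R -> Prop) (hD : open D)
    (f : fn3) (h : R -> R -> R)
    (hf : smooth_on D f) (hh : smooth_on D (lift h)) (A B C : fser) :
  (admissible D A /\ admissible D B /\ admissible D C /\
   solves_system D f h A B C) <->
  (exists al0 be0 ga0 : fn3,
     smooth_on D al0 /\ smooth_on D be0 /\ smooth_on D ga0 /\
     fser_eq_on D A (sol_A f al0) /\
     fser_eq_on D B (sol_B f h al0 be0) /\
     fser_eq_on D C (sol_C f h al0 be0 ga0)).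
Proof.
  split.
  - intros [HA [HB [HC [EA [EB EC]]]]].
    assert (S5 : forall s, admissible D s -> smooth_on D (s 5%Z)).
    { intros s [a [al [_ [Hal E]]]].
      apply (smooth_ext D (al 0%nat)); [exact hD | | apply Hal].
      intros x y p Hq; symmetry; exact (E 5%Z x y p Hq). }
    pose proof (S5 A HA) as H5A.
    pose proof (S5 B HB) as H5B.
    pose proof (S5 C HC) as H5C.
    (* The free functions are the coefficients of [rho^(5/2)]. *)
    exists (A 5%Z), (B 5%Z), (C 5%Z).
    assert (KA : fser_eq_on D A (sol_A f (A 5%Z))).
    { apply admissible_unique; auto using admissible_sol_A.
      - intros n x y p Hq.
        rewrite (EA n x y p Hq); symmetry; now apply (L_sol_A D).
      - intros x y p _; symmetry; apply (sol_coef5 f h _ (B 5%Z) (C 5%Z)). }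
    (* The system is triangular: once [A] is explicit, the right-hand side for [B] is that of
       [L_sol_B], and [C] follows likewise. *)
    assert (KB : fser_eq_on D B (sol_B f h (A 5%Z) (B 5%Z))).
    { apply admissible_unique; auto using admissible_sol_B.
      - intros n x y p Hq.
        rewrite (EB n x y p Hq), (fser_p_ext D _ _ hD KA n x y p Hq).
        symmetry; now apply (L_sol_B D).
      - intros x y p _; symmetry; apply (sol_coef5 f h _ (B 5%Z) (C 5%Z)). }
    do 5 (split; [assumption|]).
    apply admissible_unique; auto using admissible_sol_C.
    + intros n x y p Hq.
      rewrite (EC n x y p Hq), (fser_p_ext D _ _ hD KB n x y p Hq), (KA n x y p Hq).
      symmetry; now apply (L_sol_C D).
    + intros x y p _; symmetry; apply (sol_coef5 f h _ (B 5%Z) (C 5%Z)).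
  - intros [al0 [be0 [ga0 [Ha [Hb [Hg [KA [KB KC]]]]]]]].
    split; [apply (admissible_ext D A _ KA); now apply admissible_sol_A|].
    split; [apply (admissible_ext D B _ KB); now apply admissible_sol_B|].
    split; [apply (admissible_ext D C _ KC); now apply admissible_sol_C|].
    split; [|split]; intros n x y p Hq.
    + rewrite (L_ext D _ _ hD KA n x y p Hq); now apply (L_sol_A D).
    + rewrite (L_ext D _ _ hD KB n x y p Hq), (fser_p_ext D _ _ hD KA n x y p Hq).
      now apply (L_sol_B D).
    + rewrite (L_ext D _ _ hD KC n x y p Hq), (fser_p_ext D _ _ hD KB n x y p Hq),
        (KA n x y p Hq).
      now apply (L_sol_C D).
Qed.
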